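(* Every graph with geodesic treewidth $1$ has row treewidth at most $7$.
   Context: All graphs are undirected, without loops and multi-edges. A geodesic in a graph $G$ is a path in $G$ that is a shortest path between its two endpoints (a single vertex is a geodesic). A partition $\mathcal{P}$ of $G$ is a set of induced subgraphs (parts) whose vertex sets partition $V(G)$; it is a partition into geodesics if the vertices of each part are exactly the vertices of a geodesic of $G$. The quotient $G/\mathcal{P}$ is the simple graph obtained from $G$ by contracting (identifying) each part into a single vertex, removing loops and multi-edges. The geodesic treewidth of $G$ is the smallest $k$ for which there is a partition $\mathcal{P}$ of $G$ into geodesics such that $G/\mathcal{P}$ has treewidth $k$. The row treewidth of $G$ is the smallest $k$ such that $G$ is isomorphic to a subgraph of the strong product $H \boxtimes P$ for some graph $H$ of treewidth $k$ and some path $P$. *)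

(* Defs.v *)
(* Mathematical Components; all graphs are finite and simple. *)
From mathcomp Require Import all_boot.

Set Implicit Arguments.
Unset Strict Implicit.
Unset Printing Implicit Defensive.

Record sgraph := SGraph {
  vertex :> finType;
  adj : rel vertex;
  adj_sym : symmetric adj;
  adj_irrefl : irreflexive adj
}.

Definition least (P : nat -> Prop) (k : nat) : Prop :=
  P k /\ forall j, P j -> k <= j.

Definition is_tree (T : sgraph) : Prop :=
  [/\ 0 < #|T|,
      forall s t : T, connect (@adj T) s t
    & forall c : seq T, ucycle (@adj T) c -> size c <= 2].

Definition tree_decomposition (G T : sgraph) (bag : T -> {set G}) : Prop :=
  [/\ is_tree T,
      forall v : G, exists t, v \in bag t,
      forall u v : G, adj u v -> exists t, (u \in bag t) && (v \in bag t)
    & forall (v : G) (s t : T), v \in bag s -> v \in bag t ->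
        connect [rel a b | [&& v \in bag a, v \in bag b & adj a b]] s t].

(* Truncated predecessor: the graph without vertices gets treewidth 0. *)
Definition width (G T : sgraph) (bag : T -> {set G}) : nat :=
  (\max_(t : T) #|bag t|).-1.

Definition treewidth (G : sgraph) : nat -> Prop :=
  least (fun k => exists (T : sgraph) (bag : T -> {set G}),
    tree_decomposition bag /\ width bag = k).

(* The vertex sequence x :: p; size p is its number of edges. *)
Definition geodesic (G : sgraph) (x : G) (p : seq G) : Prop :=
  [/\ path (@adj G) x p, uniq (x :: p)
    & forall q, path (@adj G) x q -> last x q = last x p -> size p <= size q].

(* Parts, being induced subgraphs, are given by their vertex sets. *)
Definition geodesic_partition (G : sgraph) (P : {set {set G}}) : Prop :=
  partition P [set: G] /\
  forall A, A \in P ->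
    exists (x : G) (p : seq G), geodesic x p /\ A = [set z in x :: p].

Section Quotient.
Variables (G : sgraph) (P : {set {set G}}).

Definition quotient_adj : rel {A : {set G} | A \in P} :=
  fun A B => (A != B) && [exists x in val A, exists y in val B, adj x y].

Lemma quotient_adj_sym : symmetric quotient_adj.
Proof.
move=> A B; rewrite /quotient_adj eq_sym; congr (_ && _).
by apply/exists_inP/exists_inP => -[x xA /exists_inP [y yB e]];
  exists y => //; apply/exists_inP; exists x; rewrite // adj_sym.
Qed.

Lemma quotient_adj_irrefl : irreflexive quotient_adj.
Proof. by move=> A; rewrite /quotient_adj eqxx. Qed.

Definition quotient_graph : sgraph :=
  SGraph quotient_adj_sym quotient_adj_irrefl.

End Quotient.

Definition geodesic_treewidth (G : sgraph) : nat -> Prop :=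
  least (fun k => exists P : {set {set G}},
    geodesic_partition P /\ treewidth (quotient_graph P) k).

Section StrongProduct.
Variables G H : sgraph.

Definition strong_adj : rel (G * H) := fun u v =>
  [&& u != v, (u.1 == v.1) || adj u.1 v.1 & (u.2 == v.2) || adj u.2 v.2].

Lemma strong_adj_sym : symmetric strong_adj.
Proof.
move=> u v; rewrite /strong_adj eq_sym (eq_sym u.1) (eq_sym u.2).
by rewrite (adj_sym u.1) (adj_sym u.2).
Qed.

Lemma strong_adj_irrefl : irreflexive strong_adj.
Proof. by move=> u; rewrite /strong_adj eqxx. Qed.

Definition strong_product : sgraph := SGraph strong_adj_sym strong_adj_irrefl.

End StrongProduct.

Section PathGraph.
Variable n : nat.

Definition path_adj : rel 'I_n.+1 := fun i j => (i.+1 == j) || (j.+1 == i).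

Lemma path_adj_sym : symmetric path_adj.
Proof. by move=> i j; rewrite /path_adj orbC. Qed.

Lemma path_adj_irrefl : irreflexive path_adj.
Proof. by move=> i; rewrite /path_adj orbb gtn_eqF. Qed.

(* n edges, n.+1 vertices *)
Definition path_graph : sgraph := SGraph path_adj_sym path_adj_irrefl.

End PathGraph.

Definition isomorphic_to_subgraph (G H : sgraph) : Prop :=
  exists f : G -> H, injective f /\ forall u v : G, adj u v -> adj (f u) (f v).

Definition row_treewidth (G : sgraph) : nat -> Prop :=
  least (fun k => exists (H : sgraph) (n : nat),
    treewidth H k /\
    isomorphic_to_subgraph G (strong_product H (path_graph n))).

(* Main.v *)
(* Each part can be laid out isometrically on the integer line so that every edge
   between two parts has length at most 4.  Parts are adjusted one after the
   other along a tree decomposition of width 1 of the quotient Q, so a new part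
   has to fit at most one part already placed.  It can be reflected and
   translated to do so: both parts being geodesics, the distances between the
   ends of two edges joining them, measured along either part, differ by at
   most 2.  Cutting the line into blocks of length 4, adjacent vertices lie in
   the same or in consecutive blocks, and sending a vertex to (its part, its
   position modulo 4, its block) embeds G in (Q x K_4) x path.  Blowing up bags
   of Q of size at most 2 gives bags of size at most 8. *)
Require Import Defs.
From mathcomp Require Import all_boot.
From Stdlib Require Import Classical.
From mathcomp Require Import order ssralg ssrnum ssrint zify.

Set Implicit Arguments.
Unset Strict Implicit.
Unset Printing Implicit Defensive.

(** * Least elements, and the inequality behind the alignment *)

Lemma least_exists (P : nat -> Prop) n : P n -> exists2 m, least P m & m <= n.
Proof.
elim/ltn_ind: n => n IHn Pn.
(* [P] need not be decidable, so the case split is classical. *)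
have [[m lt_mn Pm]|minn] := classic (exists2 m, m < n & P m).
  by have [k leastk le_km] := IHn m lt_mn Pm; exists k => //; lia.
exists n => //; split=> // j Pj; case: leqP => // lt_jn.
by case: minn; exists j.
Qed.

(** Take [b0 <= b1]. For [b0 <= b] the quantity is the difference of the distances from [a] to [a0]
    and from [b] to [b0], at most 2. For [b < b0] it is their sum: comparing with [a1] and [b1]
    loses 2 twice, which gives 4. The other sign is the mirror image. *)
Lemma reflect_translate_bound (a b a0 b0 a1 b1 : int) :
  `|(a - a0)%R| <= `|(b - b0)%R| + 2 -> `|(b - b0)%R| <= `|(a - a0)%R| + 2 ->
  `|(b - b1)%R| <= `|(a - a1)%R| + 2 -> `|(a1 - a0)%R| <= `|(b1 - b0)%R| + 2 ->
  (a <= a1)%R -> (a0 <= a)%R ->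
  `|(a - ((if (b0 <= b1)%R then a0 - b0 else a0 + b0) +
          if (b0 <= b1)%R then b else - b))%R| <= 4.
Proof.
move=> h1 h2 h3 h4 le1 le0.
have {le0} [x ex x0] : exists2 x : int, a = (a0 + x)%R & (0 <= x)%R
  by exists (a - a0)%R; lia.
have {le1} [y ey y0] : exists2 y : int, a1 = (a + y)%R & (0 <= y)%R
  by exists (a1 - a)%R; lia.
subst a1 a.
case: (boolP (b0 <= b1)%R) => lb.
  case: (boolP (b0 <= b)%R) => lb'; first by clear h3 h4; lia.
  by clear h1 h2; lia.
case: (boolP (b <= b0)%R) => lb'; first by clear h3 h4; lia.
by clear h1 h2; lia.
Qed.

(** * Walks and isometric layouts of vertex sets *)

Section Reach.
Variable G : sgraph.
Implicit Types x y z : G.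

Definition reach n x y :=
  exists q, [/\ path (@adj G) x q, last x q = y & size q = n].

Lemma reach0 x y : reach 0 x y -> x = y.
Proof. by case=> q [_ <- /size0nil->]. Qed.

Lemma reach1 x y : adj x y -> reach 1 x y.
Proof. by move=> xy; exists [:: y]; rewrite /= xy. Qed.

Lemma reach_cat m n x y z : reach m x y -> reach n y z -> reach (m + n) x z.
Proof.
move=> [p [xp xpy <-]] [q [yq yqz <-]]; exists (p ++ q).
by rewrite cat_path last_cat xpy xp yq size_cat.
Qed.

Lemma reach_sym n x y : reach n x y -> reach n y x.
Proof.
move=> [p [xp xpy <-]]; exists (rev (belast x p)); split.
- by rewrite -xpy rev_path; under eq_path do rewrite adj_sym.
- by case: p xp xpy => [|z p] //= _ _; rewrite rev_cons last_rcons.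
- by rewrite size_rev size_belast.
Qed.

Lemma path_reach x p i j : path (@adj G) x p -> i <= j <= size p ->
  reach (j - i) (nth x (x :: p) i) (nth x (x :: p) j).
Proof.
move=> xp /andP[]; elim: j => [|j IHj] le_ij le_jp.
  by exists [::]; split; move: le_ij; rewrite leqn0 => // /eqP->.
have [->|ne_ij] := eqVneq i j.+1; first by exists [::]; rewrite subnn.
have -> : j.+1 - i = j - i + 1 by lia.
apply: reach_cat (IHj _ _) (reach1 _); try lia.
by move/pathP: xp => /(_ x j le_jp).
Qed.

(** Distances are those of the whole graph [G], so that walks leaving [A] are controlled as well. *)
Definition isometric_on (f : G -> int) (A : {set G}) := forall x y,
  x \in A -> y \in A ->
  reach `|(f x - f y)%R| x y /\ forall n, reach n x y -> `|(f x - f y)%R| <= n.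

Lemma isometric_adj (f : G -> int) (A : {set G}) x y :
  isometric_on f A -> x \in A -> y \in A -> adj x y -> `|(f x - f y)%R| <= 1.
Proof. by move=> fA xA yA /reach1; apply: (fA x y xA yA).2. Qed.

Lemma isometric_inj (f : G -> int) (A : {set G}) :
  isometric_on f A -> {in A &, injective f}.
Proof.
move=> fA x y xA yA exy; apply: reach0.
by have [+ _] := fA x y xA yA; rewrite exy GRing.subrr.
Qed.

Lemma eq_isometric (f g : G -> int) (A : {set G}) :
  {in A &, forall x y, `|(f x - f y)%R| = `|(g x - g y)%R|} ->
  isometric_on f A -> isometric_on g A.
Proof. by move=> efg fA x y xA yA; rewrite -efg //; apply: fA. Qed.

(** Any walk between two vertices of a geodesic can replace the stretch between them, and the
    resulting walk between the ends cannot be shorter than [p]. *)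
Lemma geodesic_isometric x p : geodesic x p ->
  isometric_on (fun z => Posz (index z (x :: p))) [set z in x :: p].
Proof.
case=> xp _ minp; set s := x :: p.
suff le_index y z : y \in s -> z \in s -> index y s <= index z s ->
    reach (index z s - index y s) y z /\
    forall n, reach n y z -> index z s - index y s <= n.
  move=> y z; rewrite !in_set => ys zs.
  have [le_yz|/ltnW le_zy] := leqP (index y s) (index z s).
    have [r m] := le_index y z ys zs le_yz.
    by have -> : `|(Posz (index y s) - Posz (index z s))%R|
      = index z s - index y s by lia.
  have [r m] := le_index z y zs ys le_zy.
  have -> : `|(Posz (index y s) - Posz (index z s))%R|
    = index y s - index z s by lia.
  by split=> [|n /reach_sym /m //]; apply: reach_sym.
move=> ys zs le_yz.
have ltz : index z s <= size p.
  by rewrite -ltnS -[(size p).+1]/(size s) index_mem.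
split.
  by have := @path_reach x p _ _ xp (introT andP (conj le_yz ltz));
     rewrite !nth_index.
move=> n yzn.
have xy : reach (index y s) x y.
  have := @path_reach x p 0 (index y s) xp.
  by rewrite nth_index // subn0; apply; lia.
have zl : reach (size p - index z s) z (last x p).
  have := @path_reach x p (index z s) (size p) xp.
  rewrite nth_index // -[nth _ _ (size p)]/(nth x s (size s).-1) nth_last.
  by apply; lia.
have [q [xq lq sq]] := reach_cat (reach_cat xy yzn) zl.
by have := minp q xq lq; rewrite sq; lia.
Qed.

Definition close_on (f : G -> int) (A B : {set G}) := forall x y,
  x \in A -> y \in B -> adj x y -> `|(f x - f y)%R| <= 4.

Lemma close_sym f A B : close_on f A B -> close_on f B A.
Proof.
move=> fAB x y xB yA; rewrite adj_sym => xy.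
by have := fAB y x yA xB xy; lia.
Qed.

Lemma isometric_close f A : isometric_on f A -> close_on f A A.
Proof. by move=> fA x y xA yA xy; have := isometric_adj fA xA yA xy; lia. Qed.

(** The detour from [x] to [y], on to [y'] and back to [x'] has length [n + 2], and [f] measures
    distance on [A]. *)
Lemma isometric_cross (f : G -> int) (A : {set G}) x y x' y' :
  isometric_on f A -> x \in A -> x' \in A -> adj x y -> adj x' y' ->
  forall n, reach n y y' ->
  `|(f x - f x')%R| <= n + 2.
Proof.
move=> fA xA x'A xy; rewrite adj_sym => x'y' n yy'.
have xx' := reach_cat (reach_cat (reach1 xy) yy') (reach1 x'y').
by have := (fA x x' xA x'A).2 _ xx'; lia.
Qed.

(* The offset comes from the edge of smallest [f]-value in [A], the sign from
   comparing it with the edge of largest [f]-value. *)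
Lemma align f A B : isometric_on f A -> isometric_on f B ->
  exists (s : bool) (c : int), forall x y, x \in A -> y \in B -> adj x y ->
    `|(f x - (c + if s then f y else - f y))%R| <= 4.
Proof.
move=> fA fB.
pose E := [pred e : G * G | [&& e.1 \in A, e.2 \in B & adj e.1 e.2]].
case: (pickP E) => [e0 Ee0|noE]; last first.
  exists true, 0%R => x y xA yB xy.
  by have := noE (x, y); rewrite /= xA yB xy.
have cross x y x' y' : x \in A -> y \in B -> adj x y ->
    x' \in A -> y' \in B -> adj x' y' ->
    `|(f x - f x')%R| <= `|(f y - f y')%R| + 2 /\
    `|(f y - f y')%R| <= `|(f x - f x')%R| + 2.
  move=> xA yB xy x'A y'B x'y'; split.
    exact: isometric_cross fA xA x'A xy x'y' _ (fB y y' yB y'B).1.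
  apply: isometric_cross fB yB y'B _ _ _ (fA x x' xA x'A).1; by rewrite adj_sym.
case: (@Order.TotalTheory.arg_minP _ int _ e0 E (fun e => f e.1) Ee0).
move=> [p0 q0] /and3P[/= p0A q0B pq0] min0.
case: (@Order.TotalTheory.arg_maxP _ int _ e0 E (fun e => f e.1) Ee0).
move=> [p1 q1] /and3P[/= p1A q1B pq1] max1.
exists (f q0 <= f q1)%R.
exists (if (f q0 <= f q1)%R then f p0 - f q0 else f p0 + f q0)%R.
move=> x y xA yB xy.
have Exy : E (x, y) by rewrite /= xA yB xy.
have := min0 _ Exy; have := max1 _ Exy => /=.
have [le_xy0 le_yx0] := cross _ _ _ _ xA yB xy p0A q0B pq0.
have [_ le_yx1] := cross _ _ _ _ xA yB xy p1A q1B pq1.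
have [le_xy01 _] := cross _ _ _ _ p1A q1B pq1 p0A q0B pq0.
exact: reflect_translate_bound.
Qed.

End Reach.

(** * Building up a tree decomposition node by node *)

Section TreeInduction.
Variables (G T : sgraph) (bag : T -> {set G}).
Hypothesis td : tree_decomposition bag.

Let inner (W : {set T}) : rel T := [rel a b | [&& a \in W, b \in W & adj a b]].
Let linked (W : {set T}) := {in W &, forall a b, connect (inner W) a b}.

Let inner_sub (W W' : {set T}) : W \subset W' ->
  subrel (connect (inner W)) (connect (inner W')).
Proof.
move=> /subsetP sWW'; apply: connect_sub => a b /and3P[aW bW ab].
by apply: connect1; rewrite /inner /= !sWW'.
Qed.

Let inner_sym W : connect_sym (inner W).
Proof. by apply: sym_connect_sym => a b; rewrite /inner /= andbCA adj_sym. Qed.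

Let linked_grow (W : {set T}) w t :
  w \in W -> adj w t -> linked W -> linked (t |: W).
Proof.
move=> wW wt lW.
have conn a : a \in t |: W -> connect (inner (t |: W)) w a.
  rewrite in_setU1 => /orP[/eqP->|aW].
    by apply: connect1; rewrite /inner /= !inE eqxx wW orbT.
  by apply: inner_sub (lW w a wW aW); apply: subsetUr.
by move=> a b /conn wa /conn; apply: connect_trans; rewrite inner_sym.
Qed.

(* A path from [t] into [W] through the bags of [v] and a path back to [w]
   inside [W] close up to a cycle, which must be the edge [t w]. *)
Let attached (W : {set T}) w t v w' : linked W -> w \in W -> t \notin W ->
  adj w t -> v \in bag t -> w' \in W -> v \in bag w' -> v \in bag w.
Proof.
case: td => -[_ _ acyc] _ _ conn lW wW tW wt vt w'W vw'.
have /connectP[p0 tp0 lp0] := conn v t w' vt vw'.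
move: lp0; case/shortenP: tp0 => p tp up _ lp {p0}.
have hasW : has (mem W) p.
  apply/hasP; exists w' => //; case: p lp {tp up} => [/= e|a p /= ->].
    by move: tW; rewrite -e w'W.
  exact: mem_last.
(* [y] is the first node of the path that lies in [W]; the piece [p1] before it avoids [W]. *)
case: (split_find hasW) tp up => y p1 p2 yW /hasPn p1W.
rewrite cat_path rcons_path => /andP[/andP[tp1 /and3P[_ vy xy]] _].
rewrite -cat_cons cat_uniq -rcons_cons rcons_uniq.
case/and3P => /andP[_ up1] _ _.
have /connectP[q0 yq0 lq0] := lW y w yW wW.
move: lq0; case/shortenP: yq0 => q yq uq _ lq {q0}.
have qW : {subset y :: q <= W}.
  move=> a; rewrite inE => /orP[/eqP->//|]; move: yq; clear -y.
  elim: q y => //= b q IHq y /andP[/and3P[_ bW _] bq].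
  by rewrite inE => /orP[/eqP->//|]; apply: IHq bq.
have sub1 : path (@adj T) t p1.
  by apply: sub_path tp1 => a b /= /and3P[].
have sub2 : path (@adj T) y q.
  by apply: sub_path yq => a b /= /and3P[].
have cyc : ucycle (@adj T) (t :: p1 ++ y :: q).
  apply/andP; split.
    rewrite /= rcons_cat cat_path sub1 /= xy rcons_path sub2.
    by rewrite -lq adj_sym [adj t w]adj_sym wt.
  rewrite -cat_cons cat_uniq up1 uq andbT; apply/hasPn => a /qW aW.
  rewrite inE negb_or; apply/andP; split.
    by apply: contraNneq tW => <-.
  by apply: contraTN aW => /p1W.
(* The cycle has [size p1 + size q + 2] nodes, so [q] is empty and [w] is [y], whose bag contains
   [v]. *)
have := acyc _ cyc; rewrite /= size_cat /= !addnS !ltnS leqn0 addn_eq0.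
by case/andP=> _ /nilP q0; rewrite lq q0.
Qed.

(** Nodes are added to a subtree [W] along tree edges. If a bag brings no new vertex, [attached]
    puts all of it into the bag of the neighbour in [W]. The empty bag is a separate case because
    the first node has no such neighbour. *)
Lemma tree_decomposition_ind (Q : {set T} -> Prop) :
  Q set0 ->
  (forall W t, Q W ->
     (exists2 v, v \in bag t & forall w, w \in W -> v \notin bag w) \/
     (exists2 w, w \in W & bag t \subset bag w) \/ bag t = set0 ->
   Q (t |: W)) ->
  Q setT.
Proof.
move=> Q0 QS.
suff grow n (W : {set T}) : #|~: W| <= n -> linked W -> Q W -> Q setT.
  by apply: (grow _ set0 (leqnn _)) => // a b; rewrite inE.
elim: n W => [|n IHn] W.
  by rewrite leqn0 cards_eq0 => /eqP /(canRL setCK); rewrite setC0 => ->.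
move=> szW lW QW.
have step t : t \notin W -> linked (t |: W) ->
    (exists2 v, v \in bag t & forall w, w \in W -> v \notin bag w) \/
    (exists2 w, w \in W & bag t \subset bag w) \/ bag t = set0 -> Q setT.
  move=> tW ltW bt; apply: (IHn (t |: W)) => //; last exact: QS.
  rewrite setCU setIC -setDE; move: szW; rewrite (cardsD1 t) inE tW; exact.
have [[r0 Tconn _] _ _ _] := td; case: (set_0Vmem W) => [W0|[w0 w0W]].
  have /card_gt0P[t _] := r0.
  apply: (step t); rewrite ?W0 ?inE // ?setU0.
    by move=> a b /set1P-> /set1P->.
  case: (set_0Vmem (bag t)) => [|[v vt]]; first by auto.
  by left; exists v => // w; rewrite inE.
case: (pickP [pred e : T * T | [&& e.1 \in W, e.2 \notin W & adj e.1 e.2]]).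
  move=> [w t] /and3P[/= wW tW wt]; apply: (step t tW (linked_grow wW wt lW)).
  case: (pickP [pred v in bag t | [forall x in W, v \notin bag x]]).
    by move=> v /andP[vt /forall_inP vW]; left; exists v.
  move=> old; right; left; exists w => //; apply/subsetP => v vt.
  have := old v; rewrite /= vt => /forall_inPn[w' w'W]; rewrite negbK.
  exact: (attached lW wW tW wt vt w'W).
(* No edge leaves the nonempty [W], so connectedness of [T] makes it everything. *)
move=> noedge; have closedW : closed (@adj T) W.
  apply: intro_closed => [|a b ab aW]; first exact/sym_connect_sym/adj_sym.
  by have := noedge (a, b); rewrite /= aW ab andbT /= => /negbFE.
suff -> : [set: T] = W by [].
by apply/setP => a; rewrite inE -(closed_connect closedW (Tconn w0 a)) w0W.
Qed.

End TreeInduction.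

(** * Aligning all the parts *)

Lemma geodesic_partition_isometric (G : sgraph) (P : {set {set G}}) :
  geodesic_partition P ->
  exists f, forall A, A \in P -> isometric_on f A.
Proof.
case=> [/and3P[_ tiP _] geoP].
(* Every vertex set gets a layout, a dummy one outside [P]; as the parts are disjoint, [pblock] then
   selects the right one. *)
have choice (A : {set G}) : exists g : G -> int, A \in P -> isometric_on g A.
  case: (boolP (A \in P)) => [AP|_]; last by exists (fun=> 0%R).
  have [x [p [geo ->]]] := geoP A AP.
  by exists (fun z => Posz (index z (x :: p))) => _; apply: geodesic_isometric.
have [g isog] := fin_all_exists choice.
exists (fun x => g (pblock P x) x) => A AP.
by apply: eq_isometric (isog A AP) => x y xA yA; rewrite !(def_pblock tiP AP).
Qed.

Lemma alignment (G : sgraph) (P : {set {set G}}) (T : sgraph)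
    (bag : T -> {set quotient_graph P}) :
  geodesic_partition P -> tree_decomposition bag ->
  (forall t, #|bag t| <= 2) ->
  exists f, (forall A, A \in P -> isometric_on f A) /\
    forall x y : G, adj x y -> `|(f x - f y)%R| <= 4.
Proof.
move=> geoP td bag2.
have /and3P[/eqP coverP /trivIsetP tiP _] := geoP.1.
pose good (W : {set T}) := exists f, (forall A, A \in P -> isometric_on f A) /\
  forall t (A B : quotient_graph P), t \in W -> A \in bag t -> B \in bag t ->
    close_on f (val A) (val B).
suff [f [isof closef]] : good setT.
  exists f; split=> // x y xy.
  have cov z : z \in cover P by rewrite coverP inE.
  pose A : quotient_graph P := Sub (pblock P x) (pblock_mem (cov x)).
  pose B : quotient_graph P := Sub (pblock P y) (pblock_mem (cov y)).
  have xA : x \in val A by rewrite /= mem_pblock.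
  have yB : y \in val B by rewrite /= mem_pblock.
  have [eqAB|neAB] := eqVneq A B.
    rewrite -eqAB in yB.
    exact: isometric_close (isof _ (valP A)) _ _ xA yB xy.
  case: td => _ _ edge _; have [|t /andP[At Bt]] := edge A B.
    rewrite /= /quotient_adj neAB /=.
    by apply/exists_inP; exists x => //; apply/exists_inP; exists y.
  exact: (closef t A B) xA yB xy.
apply: (tree_decomposition_ind td) => [|W t [f [isof closef]]].
  have [f isof] := geodesic_partition_isometric geoP.
  by exists f; split=> // t A B; rewrite inE.
case=> [[B Bt newB]|old]; last first.
  exists f; split=> // t' A B.
  rewrite in_setU1 => /orP[/eqP->|]; last exact: closef.
  case: old => [[w wW /subsetP sub]|->]; last by rewrite inE.
  by move=> /sub Aw /sub Bw; apply: closef wW Aw Bw.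
(* If [B] is alone in its bag, [A] is [B] itself as a placeholder, and nothing has to be moved. *)
have [A [btE neAB]] :
    exists A, {subset bag t <= [set A; B]} /\ (A != B \/ bag t = [set B]).
  case: (set_0Vmem (bag t :\ B)) => [/eqP e|[A]].
    exists B; have e' : bag t = [set B].
      by apply/eqP; rewrite eqEsubset sub1set Bt andbT -setD_eq0.
    by split; [rewrite e' => C; rewrite !inE => ->|right].
  rewrite !inE => /andP[neAB At]; exists A; split; last by left.
  move=> C Ct; suff -> : [set A; B] = bag t by [].
  apply/eqP; rewrite eqEcard cards2 neAB bag2 andbT.
  by apply/subsetP => D /set2P[]->.
case: neAB => [neAB|eB]; last first.
  exists f; split=> // t' C D.
  rewrite in_setU1 => /orP[/eqP->|]; last exact: closef.
  by rewrite eB => /set1P-> /set1P->; apply/isometric_close/isof/valP.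
have [s [c fAB]] := align (isof _ (valP A)) (isof _ (valP B)).
(* Only [B] is moved; being new, it occurs in no bag of [W], so the earlier estimates survive. *)
pose g x := if x \in val B then (c + if s then f x else - f x)%R else f x.
have gE (C : quotient_graph P) x : C != B -> x \in val C -> g x = f x.
  move=> neCB xC; rewrite /g; case: ifP => // xB.
  have /disjointFr/(_ xC) := tiP _ _ (valP C) (valP B) neCB.
  by rewrite xB.
have isog (C : quotient_graph P) : isometric_on g (val C).
  apply: eq_isometric (isof _ (valP C)) => x y xC yC.
  have [eCB|neCB] := eqVneq C B; last by rewrite !(gE C).
  by rewrite /g -eCB xC yC; case: s {fAB g gE}; lia.
have gAB : close_on g (val A) (val B).
  by move=> x y xA yB xy; rewrite (gE A) // /g yB; apply: fAB.
exists g; split=> [C CP|t' C D]; first exact: (isog (Sub C CP)).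
rewrite in_setU1 => /orP[/eqP->|t'W Ct' Dt' x y xC yD].
  move=> /btE/set2P[]-> /btE/set2P[]->; try exact: isometric_close.
    exact: gAB.
  exact: close_sym.
have old E : E \in bag t' -> E != B by apply: contraTneq => ->; apply: newB.
by rewrite (gE C) ?(gE D) ?old //; apply: closef t'W Ct' Dt' _ _ xC yD.
Qed.

(** * Blowing up the vertices of a decomposed graph *)

Section CompleteGraph.
Variable n : nat.

Definition complete_adj : rel 'I_n := fun i j => i != j.

Lemma complete_adj_sym : symmetric complete_adj.
Proof. by move=> i j; rewrite /complete_adj eq_sym. Qed.

Lemma complete_adj_irrefl : irreflexive complete_adj.
Proof. by move=> i; rewrite /complete_adj eqxx. Qed.

Definition complete_graph : sgraph :=
  SGraph complete_adj_sym complete_adj_irrefl.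

End CompleteGraph.

Lemma tree_decomposition_blowup (G T : sgraph) (bag : T -> {set G}) n :
  tree_decomposition bag ->
  @tree_decomposition (strong_product G (complete_graph n)) T
    (fun t => setX (bag t) setT).
Proof.
case=> treeT vert edge conn; split=> //.
- by move=> [v i]; have [t vt] := vert v; exists t; rewrite !inE vt.
- move=> [u i] [v j] /and3P[/= _ /orP[/eqP->|/edge[t /andP[ut vt]]] _].
    by have [t vt] := vert v; exists t; rewrite !inE vt.
  by exists t; rewrite !inE ut vt.
- move=> [v i] s t; rewrite !inE !andbT => vs vt.
  apply: connect_sub (conn v s t vs vt) => a b ab.
  by apply: connect1; rewrite /= !inE !andbT.
Qed.

(** [treewidth] holds only of the exact minimum, which the blown-up bags merely bound from above;
    hence the existential [k]. *)
Lemma treewidth_blowup (G T : sgraph) (bag : T -> {set G}) m n :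
  tree_decomposition bag -> (forall t, #|bag t| <= m) ->
  exists2 k, treewidth (strong_product G (complete_graph n)) k
           & k <= (m * n).-1.
Proof.
move=> td bagm; have td' := tree_decomposition_blowup n td.
pose bag' (t : T) : {set strong_product G (complete_graph n)} :=
  setX (bag t) setT.
have [|k twk le_k] := @least_exists (fun k => exists (T' : sgraph)
  (b : T' -> {set strong_product G (complete_graph n)}),
  tree_decomposition b /\ width b = k) (width bag').
  by exists T, bag'.
exists k => //; apply: leq_trans le_k _; rewrite /width -!subn1 leq_sub2r //.
apply/bigmax_leqP => t _.
by rewrite /bag' cardsX cardsT card_ord leq_mul2r bagm orbT.
Qed.

(** * The embedding into the strong product *)

Lemma shift_nat (V : finType) (f : V -> int) :
  exists h : V -> nat, forall u v, (Posz (h u) - Posz (h v))%R = (f u - f v)%R.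
Proof.
(* Translating by the largest absolute value makes all positions natural numbers. *)
pose N := \max_v `|f v|; exists (fun v => `|(f v + Posz N)%R|) => u v.
have := @leq_bigmax _ (fun v => `|f v|) u.
have := @leq_bigmax _ (fun v => `|f v|) v.
rewrite -/N; lia.
Qed.

Theorem theorem4 (G : sgraph) (gtwG : geodesic_treewidth G 1) :
  exists2 k : nat, row_treewidth G k & k <= 7.
Proof.
case: gtwG => [[P [geoP [[T [bag [td width1]]] _]]] _].
have bag2 t : #|bag t| <= 2.
  have := @leq_bigmax _ (fun t => #|bag t|) t.
  by move: width1; rewrite /width; lia.
have [f [isof adjf]] := alignment geoP td bag2.
have [h hE] := shift_nat f.
(* Bags of size at most 2 and four residues give [(2 * 4).-1], which is 7. *)
have [m twm le_m7] := treewidth_blowup 4 td bag2.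
suff sub : exists n, isomorphic_to_subgraph G (strong_product
    (strong_product (quotient_graph P) (complete_graph 4)) (path_graph n)).
  have [n subn] := sub.
  have [|k rtwk le_km] := @least_exists (fun k => exists (H : sgraph) (n : nat),
    treewidth H k /\
    isomorphic_to_subgraph G (strong_product H (path_graph n))) m.
    by exists (strong_product (quotient_graph P) (complete_graph 4)), n.
  by exists k => //; apply: leq_trans le_m7.
have /and3P[/eqP coverP _ _] := geoP.1.
have cov z : z \in cover P by rewrite coverP inE.
pose part x : quotient_graph P := Sub (pblock P x) (pblock_mem (cov x)).
have in_part x : x \in val (part x) by rewrite /= mem_pblock.
(* The largest position is a crude bound on the block numbers. *)
pose n := \max_v h v; exists n.
have leh v : h v %/ 4 < n.+1.
  by have := @leq_bigmax _ h v; rewrite -/n; lia.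
pose F x : strong_product (strong_product (quotient_graph P) (complete_graph 4))
    (path_graph n) := ((part x, inord (h x %% 4)), Ordinal (leh x)).
have injF : injective F.
  move=> x y eF.
  have epart : pblock P x = pblock P y := congr1 (fun u => val u.1.1) eF.
  have emod : val (F x).1.2 = val (F y).1.2 by rewrite eF.
  have ediv : h x %/ 4 = h y %/ 4 := congr1 (fun u => val u.2) eF.
  have hxy : h x = h y.
    by move: emod; rewrite /= !inordK ?ltn_pmod // (divn_eq (h x) 4) ediv; lia.
  have isoA := isof _ (valP (part x)).
  apply: (isometric_inj isoA); rewrite ?in_part //=.
    by rewrite epart mem_pblock.
  by have := hE x y; rewrite hxy; lia.
exists F; split=> // x y xy.
have neq : x != y by apply: contraTneq xy => ->; rewrite adj_irrefl.
have le4 := adjf x y xy.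
apply/and3P; split; first by rewrite (inj_eq injF).
- rewrite /= /strong_adj /= /complete_adj.
  (* Vertices of [complete_graph 4] are always equal or adjacent, so only the parts matter: if
     distinct, they are adjacent in the quotient through [x] and [y]. *)
  case: eqVneq => //= neF; rewrite orbN andbT.
  case: (eqVneq (part x) (part y)) => //= nepart.
  rewrite /quotient_adj nepart /=.
  apply/exists_inP; exists x; rewrite ?in_part //.
  by apply/exists_inP; exists y; rewrite ?in_part.
- by have := hE x y; rewrite /= /path_adj /= -val_eqE /=; lia.
Qed.
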